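(* Let $M$ be an $n$-dimensional $G$-space admitting a $G$-invariant coframe field $\{\omega^1,\dots,\omega^n\}$ of constant structure. Let $X$ be a smooth manifold, let $\psi,\phi:X\longrightarrow M$ be immersions, and let $x_0\in X$. Then $\psi$ and $\phi$ are congruent at $x_0$ if and only if there exists $g\in G$ such that $\psi(x_0)=g\cdot\phi(x_0)$ and $\psi^*\omega^i=\phi^*\omega^i$ for all $i=1,2,\dots,n$ on a neighborhood of $x_0$.
   Context: All manifolds and maps are smooth. $G$ is an $r$-dimensional (local) Lie group; a $G$-space is a manifold $M$ on which $G$ acts smoothly (possibly only locally, and not necessarily transitively). All constructions are local: $G$ stands for a sufficiently small connected open neighborhood of the identity, and manifolds may be replaced by small connected open subsets. Congruence: immersions $\psi_1,\psi_2:X\to M$ are congruent at $x_0\in X$ if there exist an open neighborhood $U\subset X$ of $x_0$ and $g\in G$ such that $\psi_1(x)=g\cdot\psi_2(x)$ for all $x\in U$. A coframe field on $M$ is a collection of $n=\dim M$ one-forms that are linearly independent at every point. It is $G$-invariant if $g^*\omega^i=\omega^i$ for all $i$ and all $g\in G$, wherever defined. It is of constant structure if the functions $f^i_{jk}$ (with $f^i_{jk}=-f^i_{kj}$) determined by $d\omega^i=-\frac12\sum_{j,k=1}^n f^i_{jk}\,\omega^j\wedge\omega^k$ are all constant. *)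

(* Defs.v *)
From HB Require Import structures.
From mathcomp Require Import all_boot all_order all_algebra.
From mathcomp Require Import boolp classical_sets functions cardinality reals.
From mathcomp Require Import topology normedtype derive.

Set Implicit Arguments.
Unset Strict Implicit.
Unset Printing Implicit Defensive.

Import Order.TTheory GRing.Theory Num.Theory numFieldNormedType.Exports.

Local Open Scope classical_set_scope.
Local Open Scope ring_scope.

(* Smoothness on an open subset of a finite-dimensional space: a map is C^k.+1
   iff it is differentiable and all its directional derivatives are C^k. *)
Fixpoint Ck_on (R : realType) (V W : normedModType R) (k : nat)
    (U : set V) (f : V -> W) : Prop :=
  if k is k'.+1 then
    (forall x, U x -> differentiable f x) /\
    (forall v : V, Ck_on k' U (fun x => 'd f x v))
  else forall x, U x -> {for x, continuous f}.

Definition smooth_on (R : realType) (V W : normedModType R)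
    (U : set V) (f : V -> W) : Prop :=
  open U /\ forall k, Ck_on k U f.

(* A chart is a homeomorphism [coord] from the open set [dom] onto the open set
   [cod], with inverse [param]; the values of [coord] off [dom] and of [param]
   off [cod] are irrelevant. *)
Record chart (R : realType) (n : nat) (T : topologicalType) := Chart {
  dom : set T;
  cod : set 'rV[R]_n;
  coord : T -> 'rV[R]_n;
  param : 'rV[R]_n -> T;
  dom_open : open dom;
  cod_open : open cod;
  coord_cod : forall x, dom x -> cod (coord x);
  param_dom : forall y, cod y -> dom (param y);
  coordK : forall x, dom x -> param (coord x) = x;
  paramK : forall y, cod y -> coord (param y) = y;
  coord_continuous : forall x, dom x -> {for x, continuous coord};
  param_continuous : forall y, cod y -> {for y, continuous param} }.

(* The preferred chart [chart_at x] around x trivializes the tangent space at x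
   (see [tangent]). *)
Record manifold (R : realType) (n : nat) := Manifold {
  point :> topologicalType;
  atlas : set (chart R n point);
  chart_at : point -> chart R n point;
  chart_at_atlas : forall x, atlas (chart_at x);
  chart_at_dom : forall x, dom (chart_at x) x;
  atlas_smooth : forall c d, atlas c -> atlas d ->
    smooth_on [set y | cod c y /\ dom d (param c y)] (coord d \o param c);
  manifold_hausdorff : hausdorff_space point;
  manifold_second_countable : @second_countable point }.

Arguments atlas {R n} m.

Definition smooth_map_on (R : realType) (m n : nat)
    (M : manifold R m) (N : manifold R n) (U : set M) (F : M -> N) : Prop :=
  [/\ open U,
      forall x, U x -> {for x, continuous F} &
      forall c d, atlas M c -> atlas N d ->
        smooth_on [set y | [/\ cod c y, U (param c y) & dom d (F (param c y))]]
                  (coord d \o F \o param c)].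

(* Smoothness on an open subset U of the product manifold M * N, in the product
   charts. *)
Definition smooth_map2_on (R : realType) (m n p : nat)
    (M : manifold R m) (N : manifold R n) (P : manifold R p)
    (U : set (M * N)%type) (F : M -> N -> P) : Prop :=
  [/\ open U,
      forall z, U z -> {for z, continuous (fun u : (M * N)%type => F u.1 u.2)} &
      forall c d e, atlas M c -> atlas N d -> atlas P e ->
        smooth_on
          [set y : ('rV[R]_m * 'rV[R]_n)%type |
             [/\ cod c y.1, cod d y.2, U (param c y.1, param d y.2) &
                 dom e (F (param c y.1) (param d y.2))]]
          (fun y : ('rV[R]_m * 'rV[R]_n)%type =>
             coord e (F (param c y.1) (param d y.2)))].

(* A tangent vector at x is represented by its components in [chart_at x]. *)
Definition tangent (R : realType) (n : nat) (M : manifold R n) (x : M) :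
  normedModType R := 'rV[R]_n.

Definition mdiff (R : realType) (m n : nat)
    (M : manifold R m) (N : manifold R n) (F : M -> N) (x : M) :
    tangent x -> tangent (F x) :=
  'd (coord (chart_at (F x)) \o F \o param (chart_at x)) (coord (chart_at x) x).

Definition immersion (R : realType) (m n : nat)
    (M : manifold R m) (N : manifold R n) (F : M -> N) : Prop :=
  smooth_map_on setT F /\ forall x, injective (mdiff F (x := x)).

(* The pullback of a field of covectors along [param c], c an arbitrary chart:
   [chart_form c w y] is the covector w has at [param c y], read in the
   coordinates of c. *)
Definition chart_form (R : realType) (n : nat) (M : manifold R n)
    (c : chart R n M) (w : forall x : M, tangent x -> R)
    (y v : 'rV[R]_n) : R :=
  w (param c y) ('d (coord (chart_at (param c y)) \o param c) y v).

Record one_form (R : realType) (n : nat) (M : manifold R n) := OneForm {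
  form_at :> forall x : M, {scalar tangent x};
  form_smooth : forall c, atlas M c -> forall v : 'rV[R]_n,
    smooth_on (cod c)
      (fun y => chart_form c (fun x : M => form_at x) y v : R) }.

Definition pullback (R : realType) (m n : nat)
    (M : manifold R m) (N : manifold R n) (F : M -> N) (w : one_form N)
    (x : M) (v : tangent x) : R :=
  w (F x) (mdiff F v).

(* dw(v, v') = v(w(v')) - v'(w(v)) for the coordinate-constant extensions of v
   and v' in the chart [chart_at x] (whose bracket vanishes). *)
Definition ext_deriv (R : realType) (n : nat) (M : manifold R n)
    (w : one_form M) (x : M) (v v' : tangent x) : R :=
  let c := chart_at x in
  let w_c := chart_form c (fun z : M => w z) in
  'D_v (fun y => w_c y v' : R) (coord c x)
  - 'D_v' (fun y => w_c y v : R) (coord c x).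

Definition wedge (R : realType) (n : nat) (M : manifold R n)
    (a b : one_form M) (x : M) (v v' : tangent x) : R :=
  a x v * b x v' - a x v' * b x v.

Definition is_coframe (R : realType) (n : nat) (M : manifold R n)
    (w : 'I_n -> one_form M) : Prop :=
  forall (x : M) (a : 'I_n -> R),
    (forall v : tangent x, \sum_(i < n) a i * w i x v = 0) ->
    forall i, a i = 0.

Definition structure_functions (R : realType) (n : nat) (M : manifold R n)
    (w : 'I_n -> one_form M) (f : 'I_n -> 'I_n -> 'I_n -> M -> R) : Prop :=
  (forall i j k x, f i j k x = - f i k j x) /\
  (forall i (x : M) (v v' : tangent x),
     ext_deriv (w i) v v' =
     - 2^-1 * \sum_(j < n) \sum_(k < n) f i j k x * wedge (w j) (w k) v v').

Definition constant_structure (R : realType) (n : nat) (M : manifold R n)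
    (w : 'I_n -> one_form M) : Prop :=
  exists2 f, structure_functions w f &
    forall i j k, exists a, forall x, f i j k x = a.

(* Multiplication and inversion are only meaningful on the open sets [mul_dom]
   and [inv_dom]; a Lie group is the case where both are full. *)
Record local_lie_group (R : realType) (r : nat) := LocalLieGroup {
  group_manifold :> manifold R r;
  gone : group_manifold;
  gmul : group_manifold -> group_manifold -> group_manifold;
  ginv : group_manifold -> group_manifold;
  mul_dom : set (group_manifold * group_manifold)%type;
  inv_dom : set group_manifold;
  gmul_smooth : smooth_map2_on mul_dom gmul;
  ginv_smooth : smooth_map_on inv_dom ginv;
  mul_dom1g : forall g, mul_dom (gone, g);
  mul_domg1 : forall g, mul_dom (g, gone);
  gmul1g : forall g, gmul gone g = g;
  gmulg1 : forall g, gmul g gone = g;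
  gmulA : forall g h k,
    mul_dom (g, h) -> mul_dom (h, k) ->
    mul_dom (gmul g h, k) -> mul_dom (g, gmul h k) ->
    gmul g (gmul h k) = gmul (gmul g h) k;
  inv_dom1 : inv_dom gone;
  mul_domVg : forall g, inv_dom g -> mul_dom (ginv g, g);
  mul_domgV : forall g, inv_dom g -> mul_dom (g, ginv g);
  gmulVg : forall g, inv_dom g -> gmul (ginv g) g = gone;
  gmulgV : forall g, inv_dom g -> gmul g (ginv g) = gone }.

Arguments gone {R r} l.
Arguments mul_dom {R r} l.
Arguments inv_dom {R r} l.

(* A (possibly local) smooth action of G on M: g . x is only meaningful for
   (g, x) in [act_dom]. *)
Record gaction (R : realType) (r n : nat) (G : local_lie_group R r)
    (M : manifold R n) := GAction {
  act :> G -> M -> M;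
  act_dom : set (G * M)%type;
  act_smooth : smooth_map2_on act_dom act;
  act_dom1 : forall x, act_dom (gone G, x);
  act1 : forall x, act (gone G) x = x;
  actM : forall g h x,
    mul_dom G (g, h) -> act_dom (h, x) ->
    act_dom (g, act h x) -> act_dom (gmul g h, x) ->
    act (gmul g h) x = act g (act h x) }.

Arguments act_dom {R r n G M} A : rename.

Definition invariant_form (R : realType) (r n : nat) (G : local_lie_group R r)
    (M : manifold R n) (A : gaction G M) (w : one_form M) : Prop :=
  forall (g : G) (x : M), act_dom A (g, x) ->
    forall v : tangent x, pullback (A g) w v = w x v.

Definition congruent_at (R : realType) (r n p : nat) (G : local_lie_group R r)
    (M : manifold R n) (A : gaction G M) (X : manifold R p)
    (psi phi : X -> M) (x0 : X) : Prop :=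
  exists (U : set X) (g : G), [/\ open U, U x0 &
    forall x, U x -> act_dom A (g, phi x) /\ psi x = A g (phi x)].

(* Main.v *)
Require Import Defs.
From mathcomp Require Import all_boot all_order all_algebra.
From mathcomp Require Import boolp classical_sets reals topology normedtype derive.
From mathcomp Require Import functions landau ring lra.
(* Re-imported because vector.v exports another [coord]. *)
Import Defs.

Set Implicit Arguments.
Unset Strict Implicit.
Unset Printing Implicit Defensive.

Import Order.TTheory GRing.Theory Num.Theory numFieldNormedType.Exports.

Local Open Scope classical_set_scope.
Local Open Scope ring_scope.

(* An immersion psi with prescribed psi^* w^i solves, along each ray issued from
   x0, a first-order equation psi' W(psi) = a, with W the (invertible, locally
   Lipschitz) matrix of the coframe in a chart; hence psi is determined near x0
   by psi(x0) and the forms psi^* w^i.  Since the w^i are invariant, g . phi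
   induces the same forms as phi, and psi = g . phi near x0 follows: the element
   g that matches the base points is already the congruence. *)

(** * Differential estimates in normed spaces *)

(** The first-order expansion at [a] depends only on the germ and determines the differential. This
    matters because chart expressions carry arbitrary values off the chart domains, so identities
    between them hold only locally. *)
Lemma near_eq_diff (R : numFieldType) (V W : normedModType R) (f g : V -> W) a :
  (\forall x \near a, f x = g x) -> differentiable f a ->
  differentiable g a /\ 'd g a = 'd f a :> (V -> W).
Proof.
move=> fg df.
have gE : g \o shift a = cst (g a) + 'd f a +o_ 0 id.
  apply/eqaddoP => e e0; have /eqaddoP/(_ e e0) := diff_locally df.
  move: (fg); rewrite (near_shift 0 a) => fg0; apply: filterS2 fg0 => y /=.
  by rewrite subr0 !fctE /= => <-; rewrite (nbhs_singleton fg).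
have dgE : 'd g a = 'd f a :> (V -> W).
  by apply: diff_unique => //; exact: diff_continuous.
split=> //; apply/diff_locallyP; rewrite dgE; split=> //; exact: diff_continuous.
Qed.

Lemma mx_norm_leP (R : realDomainType) m n (A : 'M[R]_(m, n)) (b : R) : 0 <= b ->
  (forall i j, `|A i j| <= b) <-> `|A| <= b.
Proof.
move=> b0; rewrite [`|A|]mx_normrE; split=> [Ab|/bigmax_leP[_ Ab] i j].
  by apply/bigmax_leP; split=> // -[i j] _; exact: Ab.
exact: (Ab (i, j)).
Qed.

Lemma mx_norm_entry (R : realDomainType) m n (A : 'M[R]_(m, n)) i j : `|A i j| <= `|A|.
Proof. by move: i j; apply/mx_norm_leP. Qed.

(** The matrix norm is the largest absolute value of an entry; each entry of the product sums [n]
    terms, hence the factor [n]. *)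
Lemma norm_mulmx_le (R : realDomainType) m n p (A : 'M[R]_(m, n)) (B : 'M[R]_(n, p)) :
  `|A *m B| <= n%:R * (`|A| * `|B|).
Proof.
apply/mx_norm_leP; first by rewrite !mulr_ge0.
move=> i j; rewrite mxE (le_trans (ler_norm_sum _ _ _))//.
rewrite -[n in n%:R](card_ord n) mulr_natl -sumr_const; apply: ler_sum => k _.
by rewrite normrM ler_pM// mx_norm_entry.
Qed.

Lemma mean_value_le (R : realType) (V : normedModType R) (f : V -> R) (a v : V) (K : R) :
  (forall t : R, 0 <= t <= 1 -> differentiable f (a + t *: v)) ->
  (forall t : R, 0 <= t <= 1 -> `|'d f (a + t *: v) v| <= K) ->
  `|f (a + v) - f a| <= K.
Proof.
move=> df fK; pose s (t : R) := a + t *: v.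
have ds (t : R) : is_diff t s ( *:%R ^~ v).
  rewrite /s; have -> : (fun t : R => a + t *: v) = cst a + ( *:%R ^~ v) by [].
  by apply: is_diff_eq; rewrite fctE; apply/funext => x /=; rewrite add0r.
have dfs (t : R) : 0 <= t <= 1 -> is_derive t 1 (f \o s) ('d f (s t) v).
  move=> t01; have dft := df _ t01.
  have ddfs : differentiable (f \o s) t by apply: differentiable_comp.
  apply: DeriveDef; first exact/derivable1_diffP.
  by rewrite deriveE// diff_comp//= diff_val scale1r.
have [c c01] : exists2 c, c \in `[0, 1]%R &
    (f \o s) 1 - (f \o s) 0 = 'd f (s c) v * (1 - 0).
  apply: MVT_segment => // [t t01|].
    by apply: dfs; rewrite !ltW ?(itvP t01).
  apply: derivable_within_continuous => t t01.
  by have [] := dfs t _; rewrite ?(itvP t01).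
rewrite /s /= scale1r scale0r addr0 subr0 mulr1 => ->.
by apply: fK; rewrite !(itvP c01).
Qed.

(** The intermediate point of the mean value theorem varies with the entry, but with the max norm it
    is enough to bound each entry separately by the same [K]. *)
Lemma mean_value_mx_le (R : realType) (V : normedModType R) m n
    (f : V -> 'M[R]_(m, n)) (a v : V) (K : R) :
  (forall t : R, 0 <= t <= 1 -> differentiable f (a + t *: v)) ->
  (forall t : R, 0 <= t <= 1 -> `|'d f (a + t *: v) v| <= K) ->
  `|f (a + v) - f a| <= K.
Proof.
move=> df fK; apply/mx_norm_leP => [|i j].
  by apply: le_trans (fK 0 _); rewrite ?lexx ?ler01.
pose c (N : 'M[R]_(m, n)) : R := N i j.
have dc N : is_diff N c c.
  (* Taking an entry is packaged as a linear map, so that it is its own differential. *)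
  have @g : {linear 'M[R]_(m, n) -> R}.
    by exists c; do 2![eexists]; do ?[constructor];
      rewrite /c ?mxE// => ? *; rewrite ?mxE//; move=> ?; rewrite !mxE.
  apply: DiffDef; first exact: differentiable_coord.
  by rewrite (@diff_lin _ _ _ g)//; exact: matrix_normedtype.coord_continuous.
rewrite !mxE; apply: (@mean_value_le _ _ (c \o f)) => t t01.
  by apply: differentiable_comp; [exact: df|].
rewrite diff_comp; [|exact: df|by []].
by rewrite /= diff_val; apply: le_trans (fK t t01); exact: mx_norm_entry.
Qed.

(** In finite dimension, bounding the differential on the basis vectors bounds it uniformly in the
    direction; the [+ 1] is the slack that continuity needs to keep each bound near [a]. *)
Lemma linear_bound_near (R : realType) m (V : normedModType R) (f : 'rV[R]_m -> V) a :
  (forall v, {for a, continuous (fun x => 'd f x v)}) ->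
  exists2 K : R, 0 <= K & \forall x \near a, forall v, `|'d f x v| <= K * `|v|.
Proof.
move=> cf; exists (\sum_(j < m) (`|'d f a 'e_j| + 1)).
  by apply: sumr_ge0 => j _; rewrite addr_ge0.
have nj j : \forall x \near a, `|'d f x 'e_j| <= `|'d f a 'e_j| + 1.
  by apply: (cvgr_norm_le _ (cf 'e_j)); rewrite ltrDl.
have {}nj := filter_forall _ nj.
near=> x.
have njx : forall j, `|'d f x 'e_j| <= `|'d f a 'e_j| + 1 by near: x; exact: nj.
move=> v.
have dE : 'd f x v = \sum_(j < m) v 0 j *: 'd f x 'e_j.
  rewrite {1}[v]row_sum_delta (linear_sum ('d f x)).
  by apply: eq_bigr => j _; rewrite linearZ.
rewrite mulr_suml [X in `|X| <= _]dE (le_trans (ler_norm_sum _ _ _))//; apply: ler_sum => j _.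
rewrite normrZ mulrC ler_pM//; last exact: mx_norm_entry.
Unshelve. all: by end_near. Qed.

Lemma ball_segment (R : realType) (V : normedModType R) (a x y : V) (e t : R) :
  ball a e x -> ball a e y -> 0 <= t <= 1 -> ball a e (y + t *: (x - y)).
Proof.
rewrite -ball_normE /= => ax ay /andP[t0 t1].
have -> : a - (y + t *: (x - y)) = (1 - t) *: (a - y) + t *: (a - x).
  rewrite opprD addrA -scalerN opprB scalerBl scale1r -[RHS]addrA; congr (_ + _).
  by rewrite [RHS]addrC -scalerBr opprB [a - x + _]addrC addrA subrK.
rewrite (le_lt_trans (ler_normD _ _))// !normrZ !ger0_norm ?subr_ge0//.
(* Strictness comes from the term weighted by [t], so the endpoint [t = 0] is treated apart. *)
have [->|t0'] := eqVneq t 0; first by rewrite subr0 mul1r mul0r addr0.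
rewrite -[ltRHS]mul1r -[X in X * e](subrK t) [ltRHS]mulrDl ler_ltD//.
  by rewrite ler_wpM2l ?subr_ge0// ltW.
by rewrite ltr_pM2l// lt_neqAle eq_sym t0'.
Qed.

(** Continuous differentials are bounded near [a], and a ball is convex, so the mean value bound
    applies along the segment from [y] to [x]. Summing the bounds of all entries gives one common
    constant. *)
Lemma locally_lipschitz_mx (R : realType) k m n (f : 'rV[R]_k -> 'M[R]_(m, n)) a :
  (forall i j, \forall x \near a, differentiable (fun y => f y i j : R) x) ->
  (forall i j v, {for a, continuous (fun x => 'd (fun y => f y i j : R) x v)}) ->
  exists2 L : R, 0 <= L &
    exists2 e : R, 0 < e & forall x y, ball a e x -> ball a e y ->
      `|f x - f y| <= L * `|x - y|.
Proof.
move=> df cdf.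
pose d ij x v := 'd (fun y => f y ij.1 ij.2 : R) x v.
have /choice[K KP] (ij : 'I_m * 'I_n) : exists K : R, 0 <= K /\
    \forall x \near a, forall v, `|d ij x v| <= K * `|v|.
  by have [K] := linear_bound_near (cdf ij.1 ij.2); exists K.
exists (\sum_ij K ij); first by apply: sumr_ge0 => ij _; have [] := KP ij.
have nfK := filter_forall _ (fun ij => filterI (df ij.1 ij.2) (KP ij).2).
have [e /= e0 aeP] := (nbhs_ballP _ _).1 (nfK _ _).
exists e => // x y ax ay; apply/mx_norm_leP => [|i j].
  by rewrite mulr_ge0// sumr_ge0// => ij _; have [] := KP ij.
have xyP (t : R) : 0 <= t <= 1 -> ball a e (y + t *: (x - y)).
  exact: ball_segment.
apply: (@le_trans _ _ (K (i, j) * `|x - y|)); last first.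
  rewrite ler_wpM2r// (bigD1 (i, j))//= lerDl sumr_ge0// => ij _.
  by have [] := KP ij.
rewrite !mxE -[in f x](subrKC y x).
apply: (@mean_value_le _ _ (fun y => f y i j)) => t t01.
  by have [] := aeP _ (xyP t t01) (i, j).
by have [_] := aeP _ (xyP t t01) (i, j); exact.
Qed.

(* A substitute for Gronwall: on a segment so short that C |v| <= 1/2, the
   maximum of |h| is at most half of itself. *)
Lemma near0_of_diff_le (R : realType) (V : normedModType R) m n
    (h : V -> 'M[R]_(m, n)) (a : V) (C : R) : 0 <= C -> h a = 0 ->
  (\forall z \near a, differentiable h z /\
     forall v, `|'d h z v| <= C * `|v| * `|h z|) ->
  \forall z \near a, h z = 0.
Proof.
move=> C0 ha /nbhs_ballP[e /= e0 He].
(* The radius makes [C * |v|] at most 1/2 inside the ball; adding 1 to [C] avoids dividing by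
   zero. *)
pose d := Num.min e (2 * (C + 1))^-1.
have d0 : 0 < d by rewrite lt_min e0 invr_gt0 mulr_gt0// ltr_wpDl.
apply/nbhs_ballP; exists d => //= z az.
pose v := z - a; pose s (t : R) := a + t *: v.
have vd : `|v| < d by rewrite distrC; move: az; rewrite -ball_normE.
have Cv : C * `|v| <= 2^-1.
  have vC : `|v| <= (2 * (C + 1))^-1.
    by apply: ltW; apply: lt_le_trans vd _; rewrite ge_min lexx orbT.
  apply: le_trans (ler_wpM2l C0 vC) _.
  rewrite invfM mulrCA ler_piMr ?invr_ge0// ler_pdivrMr ?mul1r ?lerDl//.
  by rewrite ltr_wpDl.
have sP (t : R) : 0 <= t <= 1 ->
    differentiable h (s t) /\ forall v, `|'d h (s t) v| <= C * `|v| * `|h (s t)|.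
  move=> t01; apply: He; apply: ball_segment => //; last exact: ballxx.
  by apply: le_ball az; rewrite ge_min lexx.
have [c c01 cmax] : exists2 c : R, c \in `[0, 1]%R &
    forall t, t \in `[0, 1]%R -> `|h (s t)| <= `|h (s c)|.
  apply: EVT_max => //; apply: continuous_in_subspaceT => t.
  rewrite inE /= in_itv /= => /sP[dh _].
  apply: (@continuous_comp _ _ _ (h \o s) (fun y => `|y|)); last exact: norm_continuous.
  apply: (@continuous_comp _ _ _ s h); last exact: differentiable_continuous.
  by apply: continuousD; [exact: cst_continuous|exact: scalel_continuous].
(* The mean value bound from [a] to the maximum point [s c]: on this subsegment [|h|] never exceeds
   [|h (s c)|], and [h a = 0]. *)
have hc : `|h (s c)| <= 2^-1 * `|h (s c)|.
  rewrite -[h (s c) in leLHS]subr0 -ha.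
  have tc (t : R) : 0 <= t <= 1 -> 0 <= t * c <= 1.
    move=> /andP[t0 t1]; rewrite in_itv/= in c01; case/andP: c01 => c0 c1.
    by rewrite mulr_ge0//= mulr_ile1.
  apply: mean_value_mx_le => t /tc tc01; rewrite scalerA.
    by have [] := sP _ tc01.
  have [_ /(_ (c *: v)) dhv] := sP _ tc01.
  apply: le_trans dhv _; apply: ler_pM => //.
  - by rewrite !mulr_ge0.
  - rewrite (le_trans _ Cv)// ler_wpM2l// normrZ ler_piMl//.
    by rewrite ger0_norm (itvP c01).
  - by apply: cmax; rewrite in_itv.
have {}hc : `|h (s c)| = 0.
  apply/eqP; rewrite eq_le normr_ge0 andbT; move: hc.
  move: `|h (s c)| => x; lra.
have /cmax : (1 : R) \in `[0, 1]%R by rewrite in_itv /= lexx ler01.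
by rewrite hc normr_le0 /s scale1r subrKC => /eqP.
Qed.

(** * Uniqueness for the moving-frame equation in coordinates *)

Lemma lipschitz_continuous_at (R : realType) (V W : normedModType R)
    (f : V -> W) (c : V) (L e : R) : 0 <= L -> 0 < e ->
  (forall y, ball c e y -> `|f c - f y| <= L * `|c - y|) ->
  {for c, continuous f}.
Proof.
move=> L0 e0 fL; apply/cvgrPdist_le => d d0.
have dL : 0 < d / (L + 1) by rewrite divr_gt0// ltr_wpDl.
near=> y; apply: le_trans (fL _ _) _; first by near: y; exact: nbhsx_ballx.
have : `|c - y| <= d / (L + 1).
  by near: y; exact: (cvgr_dist_le _ _ cvg_id _ dL).
move=> /(ler_wpM2l L0)/le_trans; apply.
by rewrite mulrCA ler_piMr ?(ltW d0)// ler_pdivrMr ?ltr_wpDl// mul1r lerDl.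
Unshelve. all: by end_near. Qed.

(** With [N] the inverse of [A c], u = u A(y) N + u (A(c) - A(y)) N. For [y] near [c] the last term
    is at most half of [|u|] and is absorbed into the left-hand side. *)
Lemma mulmx_unit_bound_near (R : realType) (T : topologicalType) n
    (A : T -> 'M[R]_n) (c : T) :
  {for c, continuous A} -> A c \in unitmx ->
  exists2 K : R, 0 <= K &
    \forall y \near c, forall u : 'rV[R]_n, `|u| <= K * `|u *m A y|.
Proof.
move=> cA Au; set N := invmx (A c).
pose k1 := n%:R * `|N|; have k10 : 0 <= k1 by rewrite mulr_ge0.
exists (2 * k1); first by rewrite mulr_ge0.
(* The tolerance on [A c - A y] is chosen so that its product with [n * k1] is at most 1/2. *)
have e0 : 0 < (2 * (n%:R * k1 + 1))^-1.
  by rewrite invr_gt0 mulr_gt0// ltr_wpDl// mulr_ge0.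
have nA : \forall y \near c, `|A c - A y| <= (2 * (n%:R * k1 + 1))^-1.
  exact: (cvgr_dist_le _ _ cA _ e0).
apply: filterS nA => y /= Ay u.
have uE : u = u *m A y *m N + u *m (A c - A y) *m N.
  by rewrite -mulmxDl -mulmxDr subrKC mulmxK.
have u1 : `|u *m A y *m N| <= k1 * `|u *m A y|.
  by rewrite (le_trans (norm_mulmx_le _ _))// mulrCA mulrC.
have u2 : `|u *m (A c - A y) *m N| <= 2^-1 * `|u|.
  rewrite (le_trans (norm_mulmx_le _ _))// mulrCA.
  rewrite mulrC (le_trans (ler_wpM2l k10 (norm_mulmx_le _ _)))//.
  have -> : k1 * (n%:R * (`|u| * `|A c - A y|)) = n%:R * k1 * `|A c - A y| * `|u|.
    by ring.
  rewrite ler_wpM2r// (le_trans (ler_wpM2l _ Ay)) ?mulr_ge0//.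
  rewrite invfM mulrCA ler_piMr ?invr_ge0// ler_pdivrMr ?mul1r ?lerDl//.
  by rewrite ltr_wpDl// mulr_ge0.
have : `|u| <= k1 * `|u *m A y| + 2^-1 * `|u|.
  by rewrite [X in `|X| <= _]uE (le_trans (ler_normD _ _))// lerD.
by rewrite -[2 * k1 * _]mulrA; move: (k1 * _) `|u| => s t; lra.
Qed.

(** As y B = x A, (x - y) B = x (B - A) up to nothing but regrouping: a difference of velocities is
    controlled by the variation of the frame. *)
Lemma norm_mulmxB_le (R : realDomainType) m n p (x y : 'M[R]_(m, n))
    (A B : 'M[R]_(n, p)) :
  x *m A = y *m B -> `|(x - y) *m B| <= n%:R * (`|x| * `|A - B|).
Proof.
by move=> xy; rewrite distrC mulmxBl -xy -mulmxBr norm_mulmx_le.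
Qed.

(** The difference h = f1 - f2 satisfies [|dh(v)| <= C |v| |h|], so [near0_of_diff_le] makes it
    vanish. The two maps enter asymmetrically: [f1] will be the smooth [psi], while [f2] will be g .
    phi, handled through pointwise differentiability. *)
Lemma moving_frame_rigidity (R : realType) p n (f1 f2 : 'rV[R]_p -> 'rV[R]_n)
    (A : 'rV[R]_n -> 'M[R]_n) a :
  f1 a = f2 a -> A (f1 a) \in unitmx ->
  (forall i j, \forall y \near f1 a, differentiable (fun y => A y i j : R) y) ->
  (forall i j v,
    {for f1 a, continuous (fun y => 'd (fun y => A y i j : R) y v)}) ->
  (\forall z \near a, differentiable f1 z) ->
  (\forall z \near a, differentiable f2 z) ->
  (forall v, {for a, continuous (fun y => 'd f1 y v)}) ->
  (\forall z \near a, forall v, 'd f1 z v *m A (f1 z) = 'd f2 z v *m A (f2 z)) ->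
  \forall z \near a, f1 z = f2 z.
Proof.
move=> fa Aunit dA cdA df1 df2 cdf1 eqA.
have [L L0 [e e0 AL]] := locally_lipschitz_mx dA cdA.
have cA : {for f1 a, continuous A}.
  by apply: (lipschitz_continuous_at L0 e0) => y; apply: AL; exact: ballxx.
have [K K0 f1K] := linear_bound_near cdf1.
have [B B0 AB] := mulmx_unit_bound_near cA Aunit.
have cf1 := differentiable_continuous (nbhs_singleton df1).
have cf2 := differentiable_continuous (nbhs_singleton df2).
have be : nbhs (f1 a) (ball (f1 a) e) by exact: nbhsx_ballx.
have f1e := cf1 _ be.
have f2e : \forall z \near a, ball (f1 a) e (f2 z) by apply: cf2; rewrite -fa.
have AB2 : \forall y \near f2 a, forall u : 'rV[R]_n, `|u| <= B * `|u *m A y|.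
  by rewrite -fa.
have f2B : \forall z \near a, forall u : 'rV[R]_n, `|u| <= B * `|u *m A (f2 z)|.
  exact: cf2 _ AB2.
suff f12 : \forall z \near a, (f1 - f2) z = 0.
  by apply: filterS f12 => z /eqP; rewrite subr_eq0 => /eqP.
(* [B] inverts the frame at [f2 z], [n] comes from the matrix product, [K] bounds the differential
   of [f1], and [L] is the Lipschitz constant of [A]. *)
apply: (@near0_of_diff_le _ _ _ _ _ _ (B * (n%:R * (K * L)))).
- by rewrite !mulr_ge0.
- by rewrite !fctE fa subrr.
near=> z.
have d1 : differentiable f1 z by near: z.
have d2 : differentiable f2 z by near: z.
split; first exact: differentiableB.
have e1 : ball (f1 a) e (f1 z) by near: z.
have e2 : ball (f1 a) e (f2 z) by near: z.
have H1 : forall v, `|'d f1 z v| <= K * `|v| by near: z.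
have H2 : forall u : 'rV[R]_n, `|u| <= B * `|u *m A (f2 z)| by near: z.
have H3 : forall v, 'd f1 z v *m A (f1 z) = 'd f2 z v *m A (f2 z) by near: z.
move=> v.
have dE : 'd (f1 - f2) z v = 'd f1 z v - 'd f2 z v.
  by have /funeqP/(_ v) := diffB d1 d2.
rewrite [X in `|X| <= _]dE.
apply: le_trans (H2 _) _.
apply: le_trans (ler_wpM2l B0 (norm_mulmxB_le (H3 v))) _.
rewrite -!mulrA; do 2![apply: ler_wpM2l => //].
apply: le_trans (ler_pM _ _ (H1 v) (AL _ _ e1 e2)) _ => //.
by rewrite !fctE mulrACA !mulrA [K * L * _]mulrAC lexx.
Unshelve. all: by end_near. Qed.

(** * Smoothness, charts and the chain rule on manifolds *)

Lemma smooth_on_differentiable (R : realType) (V W : normedModType R)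
    (U : set V) (f : V -> W) x :
  smooth_on U f -> U x -> differentiable f x.
Proof. by move=> [_ /(_ 1%N)[df _]]; exact: df. Qed.

Lemma smooth_on_near_differentiable (R : realType) (V W : normedModType R)
    (U : set V) (f : V -> W) x :
  smooth_on U f -> U x -> \forall y \near x, differentiable f y.
Proof.
move=> sf Ux; have Ux' : nbhs x U by apply: open_nbhs_nbhs; split=> //; exact: sf.1.
by apply: filterS Ux' => y; exact: smooth_on_differentiable.
Qed.

Lemma smooth_on_diff_continuous (R : realType) (V W : normedModType R)
    (U : set V) (f : V -> W) x v :
  smooth_on U f -> U x -> {for x, continuous (fun y => 'd f y v)}.
Proof. by move=> [_ /(_ 1%N)[_ /(_ v)]]; exact. Qed.

Section charts.
Context {R : realType} {n : nat} {T : topologicalType} (c : chart R n T).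

Lemma near_dom x : dom c x -> \forall y \near x, dom c y.
Proof. by move=> cx; apply: open_nbhs_nbhs; split=> //; exact: dom_open. Qed.

Lemma near_cod y : cod c y -> \forall z \near y, cod c z.
Proof. by move=> cy; apply: open_nbhs_nbhs; split=> //; exact: cod_open. Qed.

Lemma near_param x (P : set T) : dom c x ->
  (\forall y \near x, P y) -> \forall z \near coord c x, P (param c z).
Proof.
move=> cx Px; have cP := param_continuous (coord_cod cx).
by apply: cP; rewrite coordK.
Qed.

End charts.

(** A pointwise notion that composes freely and holds for g . phi wherever the action is defined.
    Continuity is required separately: it keeps [F] inside [dom d] near [x], outside of which
    [coord d] is arbitrary. *)
Definition mdifferentiable (R : realType) (m n : nat)
    (M : manifold R m) (N : manifold R n) (F : M -> N) (x : M) : Prop :=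
  {for x, continuous F} /\
  forall c d, atlas M c -> atlas N d -> dom c x -> dom d (F x) ->
    differentiable (coord d \o F \o param c) (coord c x).

Lemma smooth_map_on_mdifferentiable (R : realType) (m n : nat)
    (M : manifold R m) (N : manifold R n) (U : set M) (F : M -> N) (x : M) :
  smooth_map_on U F -> U x -> mdifferentiable F x.
Proof.
move=> [_ cF sF] Ux; split=> [|c d Mc Nd cx dFx]; first exact: cF.
by apply: smooth_on_differentiable (sF c d Mc Nd) _; split;
  rewrite ?coordK//; exact: coord_cod.
Qed.

(** In charts the identity is a transition map, so combining it with the chain rule yields the
    change-of-chart formulas. *)
Lemma mdifferentiable_id (R : realType) n (M : manifold R n) (x : M) :
  mdifferentiable id x.
Proof.
split=> [|c d Mc Md cx dx]; first exact: cvg_id.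
by apply: smooth_on_differentiable (atlas_smooth Mc Md) _; split;
  rewrite ?coordK//; exact: coord_cod.
Qed.

(** Freezing the first variable precomposes the product-chart expression with the map z -> (coord c
    x, z). *)
Lemma smooth_map2_on_mdifferentiable (R : realType) (m n p : nat)
    (M : manifold R m) (N : manifold R n) (P : manifold R p)
    (U : set (M * N)%type) (F : M -> N -> P) x y :
  smooth_map2_on U F -> U (x, y) -> mdifferentiable (F x) y.
Proof.
move=> [_ cF sF] Uxy; split=> [|d e Nd Pe dy eFxy].
  apply: (@continuous_comp _ _ _ (fun z => (x, z)) (fun u : M * N => F u.1 u.2)).
    by apply: cvg_pair; [exact: cvg_cst|exact: cvg_id].
  exact: cF.
pose c := chart_at x.
have cx : dom c x := chart_at_dom x.
have sFxy := sF c d e (chart_at_atlas x) Nd Pe.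
set G := (fun y => coord e _) in sFxy.
have -> : coord e \o F x \o param d = G \o (fun z => (coord c x, z)).
  by apply/funext => z; rewrite /G /= coordK.
apply: differentiable_comp.
  by apply: differentiable_pair; [exact: differentiable_cst|].
apply: smooth_on_differentiable sFxy _ => /=.
by rewrite !coordK//; split=> //; exact: coord_cod.
Qed.

Section chain_rule.
Context {R : realType} {m n p : nat}.
Context {M : manifold R m} {N : manifold R n} {P : manifold R p}.
Context (F : M -> N) (G : N -> P) (x : M).
Context (dF : mdifferentiable F x) (dG : mdifferentiable G (F x)).
Context (c : chart R m M) (d : chart R n N) (e : chart R p P).
Context (Mc : atlas M c) (Nd : atlas N d) (Pe : atlas P e).
Context (cx : dom c x) (dFx : dom d (F x)) (eGFx : dom e (G (F x))).

(** The chart expressions compose only where [F] stays in [dom d], which continuity ensures near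
    [x]. *)
Let comp_near : \forall y \near coord c x,
  ((coord e \o G \o param d) \o (coord d \o F \o param c)) y =
  (coord e \o (G \o F) \o param c) y.
Proof.
have := near_param cx (dF.1 _ (near_dom dFx)).
by apply: filterS => y /= dFy; rewrite coordK.
Qed.

Let dcF : differentiable (coord d \o F \o param c) (coord c x).
Proof. exact: dF.2. Qed.

Let dcG : differentiable (coord e \o G \o param d)
  ((coord d \o F \o param c) (coord c x)).
Proof. by rewrite /= coordK//; apply: dG.2. Qed.

Lemma chart_diff_comp v :
  'd (coord e \o (G \o F) \o param c) (coord c x) v =
  'd (coord e \o G \o param d) (coord d (F x))
    ('d (coord d \o F \o param c) (coord c x) v).
Proof.
have [_ /funeqP/(_ v) ->] := near_eq_diff comp_near (differentiable_comp dcF dcG).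
have /funeqP/(_ v) -> := diff_comp dcF dcG.
have -> : coord d (F x) = (coord d \o F \o param c) (coord c x).
  by rewrite /= coordK.
by [].
Qed.

Lemma mdifferentiable_comp_in_chart :
  differentiable (coord e \o (G \o F) \o param c) (coord c x).
Proof. by have [] := near_eq_diff comp_near (differentiable_comp dcF dcG). Qed.

End chain_rule.

Lemma mdifferentiable_comp (R : realType) m n p (M : manifold R m)
    (N : manifold R n) (P : manifold R p) (F : M -> N) (G : N -> P) (x : M) :
  mdifferentiable F x -> mdifferentiable G (F x) -> mdifferentiable (G \o F) x.
Proof.
move=> dF dG; split; first exact: continuous_comp dF.1 dG.1.
move=> c e Mc Pe cx eGFx.
exact: (mdifferentiable_comp_in_chart dF dG Mc (chart_at_atlas (F x)) Pe cx
  (chart_at_dom _) eGFx).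
Qed.

(** * Pullbacks of one-forms and their chart expressions *)

Lemma pullback_comp (R : realType) m n p (M : manifold R m)
    (N : manifold R n) (P : manifold R p) (F : M -> N) (G : N -> P)
    (w : one_form P) (x : M) (v : tangent x) :
  mdifferentiable F x -> mdifferentiable G (F x) ->
  pullback (G \o F) w v = pullback G w (mdiff F v).
Proof.
move=> dF dG; rewrite /pullback /mdiff; congr (w (G (F x)) _).
exact: (chart_diff_comp dF dG (chart_at_atlas x) (chart_at_atlas (F x))
  (chart_at_atlas (G (F x))) (chart_at_dom x) (chart_at_dom _) (chart_at_dom _)).
Qed.

(* Transports the type [tangent (F x)] along F x = y. *)
Lemma pullbackE (R : realType) m n (M : manifold R m) (N : manifold R n)
    (F : M -> N) (w : one_form N) (x : M) (v : tangent x) (y : N) :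
  F x = y ->
  pullback F w v =
  w y ('d (coord (chart_at y) \o F \o param (chart_at x))
         (coord (chart_at x) x) v).
Proof. by move=> <-. Qed.

Lemma near_eq_pullback (R : realType) m n (M : manifold R m) (N : manifold R n)
    (F G : M -> N) (w : one_form N) (x : M) (v : tangent x) :
  (\forall y \near x, F y = G y) -> mdifferentiable F x ->
  pullback G w v = pullback F w v.
Proof.
move=> FG [_ dF].
have cx := chart_at_dom x.
have FGc : \forall y \near coord (chart_at x) x,
    (coord (chart_at (F x)) \o F \o param (chart_at x)) y =
    (coord (chart_at (F x)) \o G \o param (chart_at x)) y.
  have nFG := near_param cx FG.
  by apply: filterS nFG => y /= ->.
have dFx : differentiable (coord (chart_at (F x)) \o F \o param (chart_at x))
    (coord (chart_at x) x).
  by apply: dF; first [exact: chart_at_atlas|exact: chart_at_dom].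
have [_ /funeqP/(_ v) dE] := near_eq_diff FGc dFx.
(* The tangent spaces at [F x] and [G x] are trivialized by charts depending on the point; transport
   along the equality [G x = F x] puts both differentials in one chart. *)
rewrite (pullbackE w v (esym (nbhs_singleton FG))).
exact: (congr1 (fun u : 'rV[R]_n => w (F x) u) dE).
Qed.

(** Both sides apply [w] to the differential of [F] from [b] to the preferred chart at [F x],
    factored through [chart_at x] on the left and through [c] on the right. *)
Lemma pullback_chart (R : realType) m n (M : manifold R m) (N : manifold R n)
    (F : M -> N) (w : one_form N) b c (x : M) (v : 'rV[R]_m) :
  mdifferentiable F x -> atlas M b -> atlas N c -> dom b x -> dom c (F x) ->
  pullback F w ('d (coord (chart_at x) \o param b) (coord b x) v : tangent x) =
  chart_form c (fun z : N => w z) (coord c (F x))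
    ('d (coord c \o F \o param b) (coord b x) v).
Proof.
move=> dF Mb Nc bx cFx.
have dFl := chart_diff_comp (@mdifferentiable_id _ _ _ x) dF Mb (chart_at_atlas x)
  (chart_at_atlas (F x)) bx (chart_at_dom x) (chart_at_dom (F x)) v.
have dFr := chart_diff_comp dF (@mdifferentiable_id _ _ _ (F x)) Mb Nc
  (chart_at_atlas (F x)) bx cFx (chart_at_dom (F x)) v.
rewrite /chart_form coordK//.
exact: (congr1 (fun u : 'rV[R]_n => w (F x) u) (etrans (esym dFl) dFr)).
Qed.

Lemma diff_coordK (R : realType) n (T : topologicalType) (c : chart R n T) x v :
  dom c x -> 'd (coord c \o param c) (coord c x) v = v.
Proof.
move=> cx; have idc : \forall y \near coord c x, y = (coord c \o param c) y.
  by have ncod := near_cod (coord_cod cx); apply: filterS ncod => y /paramK.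
have [_ /funeqP/(_ v)->] := near_eq_diff (f := id) idc (ex_diff (f := id)).
by rewrite diff_val.
Qed.

(** Tangent vectors are rows multiplying from the left, so coordinate directions index the rows and
    forms the columns. *)
Definition frame_mx (R : realType) n (M : manifold R n) (c : chart R n M)
    (w : 'I_n -> one_form M) (y : 'rV[R]_n) : 'M[R]_n :=
  \matrix_(j, i) chart_form c (fun z : M => w i z) y 'e_j.

Lemma mul_frame_mx (R : realType) n (M : manifold R n) (c : chart R n M)
    (w : 'I_n -> one_form M) (y v : 'rV[R]_n) i :
  (v *m frame_mx c w y) 0 i = chart_form c (fun z : M => w i z) y v.
Proof.
rewrite mxE [in RHS]/chart_form {2}[v]row_sum_delta !linear_sum.
by apply: eq_bigr => j _; rewrite mxE !linearZ.
Qed.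

(** A column vector killed by the matrix gives the coefficients of a linear relation among the
    coframe covectors at [x]. *)
Lemma frame_mx_unit (R : realType) n (M : manifold R n) (c : chart R n M)
    (w : 'I_n -> one_form M) (x : M) :
  is_coframe w -> atlas M c -> dom c x -> frame_mx c w (coord c x) \in unitmx.
Proof.
move=> wco Mc cx; rewrite -unitmx_tr -row_free_unit; apply: inj_row_free => a a0.
apply/rowP => i; rewrite mxE; apply: (wco x (fun i => a 0 i)) => v.
(* The transition differential from [c] to the preferred chart is onto: the reverse transition
   supplies the preimage. *)
have [u ->] : exists u, v = 'd (coord (chart_at x) \o param c) (coord c x) u.
  exists ('d (coord c \o param (chart_at x)) (coord (chart_at x) x) v).
  rewrite -[LHS](diff_coordK v (chart_at_dom x)).
  exact: (chart_diff_comp (@mdifferentiable_id _ _ _ x) (@mdifferentiable_id _ _ _ x)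
    (chart_at_atlas x) Mc (chart_at_atlas x) (chart_at_dom x) cx (chart_at_dom x)).
have Fa : frame_mx c w (coord c x) *m a^T = 0.
  by apply: trmx_inj; rewrite trmx_mul trmxK a0 trmx0.
have uFa : (u *m frame_mx c w (coord c x) *m a^T) 0 0 = 0.
  by rewrite -mulmxA Fa mulmx0 mxE.
rewrite mxE in uFa; rewrite -[RHS]uFa; apply: eq_bigr => j _.
by rewrite mul_frame_mx mulrC [a^T j 0]mxE /chart_form coordK.
Qed.

(** * Rigidity on manifolds and congruence *)

(** In charts at [x0] and [psi x0], equality of the pullbacks is exactly the equation of
    [moving_frame_rigidity] with [A] the frame matrix. *)
Lemma pullback_rigidity (R : realType) n p (M : manifold R n) (X : manifold R p)
    (w : 'I_n -> one_form M) (psi chi : X -> M) (x0 : X) :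
  is_coframe w -> smooth_map_on setT psi ->
  (\forall x \near x0, mdifferentiable chi x) -> psi x0 = chi x0 ->
  (\forall x \near x0, forall i (v : tangent x),
     pullback psi (w i) v = pullback chi (w i) v) ->
  \forall x \near x0, psi x = chi x.
Proof.
move=> wco spsi dchi psichi0 pb.
pose b := chart_at x0; pose c := chart_at (psi x0).
have bx0 : dom b x0 := chart_at_dom x0.
have cx0 : dom c (psi x0) := chart_at_dom (psi x0).
have Xb : atlas X b := chart_at_atlas x0.
have Mc : atlas M c := chart_at_atlas (psi x0).
have dpsi x : mdifferentiable psi x by exact: smooth_map_on_mdifferentiable spsi _.
have psi_dom : \forall x \near x0, dom c (psi x).
  exact: (dpsi x0).1 _ (near_dom cx0).
have chi_dom : \forall x \near x0, dom c (chi x).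
  by apply: (nbhs_singleton dchi).1; rewrite -psichi0; exact: near_dom.
pose a := coord b x0.
pose f1 := coord c \o psi \o param b; pose f2 := coord c \o chi \o param b.
have f1a : f1 a = coord c (psi x0) by rewrite /f1 /a /= coordK.
have [_ _ /(_ b c Xb Mc) sf1] := spsi.
(* Equality of the coordinate expressions suffices, since both maps stay in [dom c] near [x0], where
   [coord c] is injective. *)
suff f12 : \forall z \near a, f1 z = f2 z.
  have cz : {for x0, continuous (coord b)} := coord_continuous bx0.
  have f12' := cz _ f12.
  apply: filterS3 (filterI psi_dom chi_dom) (near_dom bx0) f12' => x [psix chix] bx f12x.
  move: f12x; rewrite /f1 /f2 /= coordK// => f12x.
  by rewrite -(coordK psix) f12x coordK.
have near_a (P : X -> Prop) : (\forall x \near x0, P x) ->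
    \forall z \near a, [/\ cod b z, P (param b z) & coord b (param b z) = z].
  move=> nP; apply: filterS2 (near_cod (coord_cod bx0)) (near_param bx0 nP) => z bz Pz.
  by split=> //; exact: paramK.
have sframe i j : smooth_on (cod c) (fun y => frame_mx c w y i j : R).
  have -> : (fun y => frame_mx c w y i j : R) =
      (fun y => chart_form c (fun z : M => w j z) y 'e_i).
    by apply/funext => y; rewrite mxE.
  exact: form_smooth.
have f1a_cod : cod c (f1 a) by rewrite f1a; exact: coord_cod.
have f1a_dom : [set y | [/\ cod b y, setT (param b y) & dom c (psi (param b y))]] a.
  by split=> //=; [exact: coord_cod|rewrite coordK].
apply: (moving_frame_rigidity (A := frame_mx c w)).
- by rewrite /f1 /f2 /a /= coordK// psichi0.
- by rewrite f1a; exact: frame_mx_unit.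
- by move=> i j; exact: smooth_on_near_differentiable (sframe i j) _.
- by move=> i j v; exact: smooth_on_diff_continuous (sframe i j) _.
- exact: smooth_on_near_differentiable sf1 _.
- apply: filterS (near_a _ (filterI dchi chi_dom)) => z [bz [dz chiz] zE].
  by rewrite -zE; apply: dz.2 => //; exact: param_dom.
- by move=> v; exact: smooth_on_diff_continuous sf1 _.
- apply: filterS (near_a _ (filterI pb (filterI dchi (filterI chi_dom psi_dom)))).
  (* Column [i] of the frame equation is the equality of pullbacks of [w i] on the tangent vector
     whose components in [b] are [v]. *)
  move=> z [bz [pbz [dchiz [chiz psiz]]] zE] v; apply/rowP => i.
  have psiE := pullback_chart (w i) v (dpsi (param b z)) Xb Mc (param_dom bz) psiz.
  have chiE := pullback_chart (w i) v dchiz Xb Mc (param_dom bz) chiz.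
  have E := etrans (esym psiE) (etrans (pbz i _) chiE); rewrite zE in E.
  exact: etrans (mul_frame_mx _ _ _ _ _) (etrans E (esym (mul_frame_mx _ _ _ _ _))).
Qed.

(** By functoriality the pullback is phi^*(g^* w), and g^* w = w. *)
Lemma pullback_act (R : realType) (r n p : nat)
    (G : local_lie_group R r) (M : manifold R n) (A : gaction G M)
    (X : manifold R p) (w : one_form M) (phi : X -> M) g x (v : tangent x) :
  invariant_form A w -> mdifferentiable phi x -> act_dom A (g, phi x) ->
  pullback (A g \o phi) w v = pullback phi w v.
Proof.
move=> winv dphi gx; rewrite pullback_comp//; first exact: winv.
exact: smooth_map2_on_mdifferentiable (act_smooth A) gx.
Qed.

Theorem theorem4p3 (R : realType) (r n p : nat)
    (G : local_lie_group R r) (M : manifold R n) (A : gaction G M)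
    (w : 'I_n -> one_form M)
    (w_coframe : is_coframe w)
    (w_invariant : forall i, invariant_form A (w i))
    (w_constant : constant_structure w)
    (X : manifold R p) (psi phi : X -> M)
    (psi_imm : immersion psi) (phi_imm : immersion phi) (x0 : X) :
  congruent_at A psi phi x0 <->
  exists g : G,
    [/\ act_dom A (g, phi x0),
        psi x0 = A g (phi x0) &
        \forall x \near x0, forall (i : 'I_n) (v : tangent x),
          pullback psi (w i) v = pullback phi (w i) v].
Proof.
have dphi x : mdifferentiable phi x.
  by case: phi_imm => sphi _; exact: smooth_map_on_mdifferentiable sphi _.
have dact g x : act_dom A (g, phi x) -> mdifferentiable (A g \o phi) x.
  move=> gx; apply: mdifferentiable_comp => //.
  exact: smooth_map2_on_mdifferentiable (act_smooth A) gx.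
split=> [[U [g [oU Ux0 UP]]]|[g [gx0 psi0 pb]]]; [exists g|].
  have [gx0 psi0] := UP _ Ux0; split=> //.
  have nU : nbhs x0 U by exact: open_nbhs_nbhs.
  apply: filterS nU => x Ux i v; have [gx _] := UP _ Ux.
  (* Pullbacks at [x] depend on germs at [x]; openness of [U] gives psi = g . phi near each of its
     points. *)
  have nUx : nbhs x U by exact: open_nbhs_nbhs.
  rewrite -(pullback_act v (w_invariant i) (dphi x) gx).
  apply: near_eq_pullback; last exact: dact.
  by apply: filterS nUx => y /UP[_ ->].
(* The domain of the local action is open, so g . phi is defined on a whole neighborhood of [x0]. *)
have nact : \forall x \near x0, act_dom A (g, phi x).
  have [oact _ _] := act_smooth A.
  have cpair : {for x0, continuous (fun x => (g, phi x))}.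
    by apply: cvg_pair; [exact: cvg_cst|exact: (dphi x0).1].
  by apply: cpair; exact: open_nbhs_nbhs.
have npsi : \forall x \near x0, psi x = (A g \o phi) x.
  have dchi : \forall x \near x0, mdifferentiable (A g \o phi) x.
    by apply: filterS nact => x; exact: dact.
  have pbE : \forall x \near x0, forall i (v : tangent x),
      pullback psi (w i) v = pullback (A g \o phi) (w i) v.
    apply: filterS2 nact pb => x gx pbx i v.
    have phiE := pullback_act v (w_invariant i) (dphi x) gx.
    have psiE := pbx i v.
    exact (etrans psiE (esym phiE)).
  by case: psi_imm => spsi _; exact: pullback_rigidity w_coframe spsi dchi psi0 pbE.
have nU : nbhs x0 [set x | act_dom A (g, phi x) /\ psi x = A g (phi x)].
  by apply: filterS2 nact npsi.
move: nU; rewrite nbhsE /= => -[U [oU Ux0] UP].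
by exists U, g; split=> // x Ux; have [] := UP x Ux.
Qed.
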